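(* Let $k\ge 2$ be an integer. For all integers $m$ and $n$, $$F^{(k)}_{m,n}=F^{(k)}_{n}F^{(k)}_{m+1}-F^{(k)}_{n+1}F^{(k)}_{m}.$$
   Context: The $k$-bonacci numbers $(F^{(k)}_n)_{n\in\mathbb{Z}}$ are the bi-infinite integer sequence with $F^{(k)}_0=\cdots=F^{(k)}_{k-2}=0$, $F^{(k)}_{k-1}=1$ and $F^{(k)}_n=\sum_{i=1}^k F^{(k)}_{n-i}$ for all $n\in\mathbb{Z}$ (for $k=2$ these are the Fibonacci numbers). Let $\phi_1,\dots,\phi_k\in\mathbb{C}$ be the roots of $x^k-x^{k-1}-\cdots-x-1$; they are distinct and nonzero. For integers $t_1,\dots,t_k$ let $\|t_1,\dots,t_k\|=\det(\phi_i^{t_j})_{1\le i,j\le k}$. The single-index numbers satisfy the Binet formula $F^{(k)}_n=\|0,1,\dots,k-2,n\|/\|0,1,\dots,k-1\|$. The two-index numbers are defined, for $m,n\in\mathbb{Z}$, by $$F^{(k)}_{m,n}=\frac{\|0,1,\dots,k-3,m,n\|}{\|0,1,\dots,k-1\|}$$ (for $k=2$ the numerator is $\|m,n\|$). *)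

(* Defs.v *)
From HB Require Import structures.
From mathcomp Require Import all_boot all_order all_algebra.
From mathcomp Require Import zify.

Set Implicit Arguments.
Unset Strict Implicit.
Unset Printing Implicit Defensive.

Import Order.TTheory GRing.Theory Num.Theory.
Local Open Scope ring_scope.

Definition is_kbonacci (k : nat) (F : int -> int) : Prop :=
  [/\ forall i : nat, (i < k.-1)%N -> F i%:Z = 0,
      F (k.-1)%:Z = 1
    & forall n : int, F n = \sum_(1 <= i < k.+1) F (n - i%:Z)].

Definition kbonacci_poly (C : nzRingType) (k : nat) : {poly C} :=
  'X^k - \sum_(i < k) 'X^i.

(* [phi] lists the [k] roots of the k-bonacci polynomial with multiplicity, so
   their distinctness is a consequence and not part of the definition. *)
Definition kbonacci_roots (C : nzRingType) (k : nat) (phi : 'I_k -> C) : Prop :=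
  kbonacci_poly C k = \prod_(i < k) ('X - (phi i)%:P).

(* || t_1, ..., t_k ||; the exponents may be negative. *)
Definition gvdet (C : fieldType) (k : nat) (phi : 'I_k -> C)
    (t : 'I_k -> int) : C :=
  \det (\matrix_(i < k, j < k) (phi i ^ t j)).

(* The exponents 0, 1, ..., k-3, m, n, for k >= 2. *)
Definition exponents2 (k : nat) (m n : int) (j : 'I_k) : int :=
  if (j < k - 2)%N then (j : nat)%:Z
  else if (j == k - 2 :> nat)%N then m else n.

Definition kbonacci2 (C : fieldType) (k : nat) (phi : 'I_k -> C)
    (m n : int) : C :=
  gvdet phi (exponents2 m n) / gvdet phi (fun j => (j : nat)%:Z).

Section Existence.
Variable k : nat.

Let rec1 (u : nat -> int) := forall n : nat,
  u (n + k)%N = \sum_(i < k) u (n + i)%N.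

Let back (u : nat -> int) (n : nat) : int :=
  if n is n'.+1 then u n' else u k.-1 - \sum_(i < k.-1) u i.

Let fwd (n : nat) : seq int :=
  iter n (fun s => rcons (behead s) (\sum_(x <- s) x))
    (rcons (nseq k.-1 0) 1).

Lemma kbonacci_exists : (0 < k)%N -> exists F, is_kbonacci k F.
Proof.
move=> k0.
have sz n : size (fwd n) = k.
  elim: n => [|n IH] /=; first by rewrite size_rcons size_nseq prednK.
  by rewrite size_rcons size_behead IH prednK.
pose u0 n := (fwd n)`_0.
have fwdE i n : (i < k)%N -> (fwd n)`_i = u0 (n + i)%N.
  elim: i n => [|i IH] n ik; first by rewrite addn0.
  rewrite addnS -addSn -IH; last exact: ltnW.
  by rewrite /= nth_rcons size_behead sz ltn_predRL ik nth_behead.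
have rec0 : rec1 u0.
  move=> n; have -> : (n + k)%N = (n.+1 + k.-1)%N by lia.
  rewrite -fwdE; last by rewrite prednK.
  rewrite /= nth_rcons size_behead sz ltnn eqxx (big_nth 0) big_mkord sz.
  by apply: eq_bigr => i _; rewrite fwdE.
have backP u : rec1 u -> rec1 (back u).
  move=> hu [|n]; last exact: hu.
  rewrite -[in RHS](big_mkord xpredT (fun i => back u (0 + i)%N)) big_ltn //.
  by rewrite big_add1 big_mkord add0n -{1}(prednK k0) /= subrK.
pose v m := iter m back u0.
have recv m : rec1 (v m) by elim: m => //= m; exact: backP.
have vE d m n : v (d + m)%N (d + n)%N = v m n by elim: d => // d <-.
pose F z := if z is Negz m then v m.+1 0%N else v 0%N `|z|%N.
have FE (m p : nat) : F (p%:Z - m%:Z) = v m p.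
  case: (leqP m p) => mp.
    have -> : p%:Z - m%:Z = (p - m)%N by lia.
    by rewrite -[LHS]/(v 0%N (p - m)%N) -(vE m) addn0 subnKC.
  have -> : p%:Z - m%:Z = Negz (m - p).-1 by lia.
  rewrite /F prednK ?subn_gt0 // -(vE p) addn0; congr v; lia.
have F0 (i : nat) : (i < k)%N -> F i%:Z = (rcons (nseq k.-1 0) 1)`_i.
  by move=> ik; rewrite -(subr0 i%:Z) FE /= -[RHS]/((fwd 0)`_i) fwdE.
exists F; split.
- move=> i ik; rewrite F0; last by rewrite (leq_trans ik) // leq_pred.
  by rewrite nth_rcons size_nseq ik nth_nseq ik.
- by rewrite F0 ?prednK // nth_rcons size_nseq ltnn eqxx.
move=> n.
have [m [p ->]] : exists m p : nat, n = (p + k)%N%:Z - m%:Z.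
  by exists (`|n| + k)%N, (absz (n + `|n|%N%:Z)); lia.
rewrite FE recv big_add1 /= big_mkord (reindex_inj rev_ord_inj) /=.
apply: eq_bigr => i _.
rewrite -FE; congr F; have := ltn_ord i; lia.
Qed.

Lemma kbonacci_unique F G :
  (0 < k)%N -> is_kbonacci k F -> is_kbonacci k G -> F =1 G.
Proof.
move=> k0 [F0 F1 Fr] [G0 G1 Gr].
have base (i : nat) : (i < k)%N -> F i%:Z = G i%:Z.
  rewrite -{1}(prednK k0) ltnS leq_eqVlt => /predU1P[->|ik].
    by rewrite F1 G1.
  by rewrite F0 ?G0.
have up (n : nat) : F n%:Z = G n%:Z.
  have [p] := ubnP n; elim: p n => // p IH n; rewrite ltnS => np.
  have [/base //|kn] := ltnP n k.
  rewrite Fr Gr; apply: eq_big_nat => i /andP[i1 ik].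
  have -> : n%:Z - i%:Z = (n - i)%N by lia.
  by apply: IH; lia.
suff down (d : nat) (n : nat) : F (n%:Z - d%:Z) = G (n%:Z - d%:Z).
  move=> z; have -> : z = (absz (z + `|z|%N%:Z))%:Z - `|z|%N%:Z by lia.
  exact: down.
elim: d n => [|d IH] n; first by rewrite subr0 up.
case: n => [|n]; last first.
  by have -> : n.+1%:Z - d.+1%:Z = n%:Z - d%:Z by lia.
have := Fr (k%:Z - d.+1%:Z); rewrite (big_nat_recr k) //=.
have -> : k%:Z - d.+1%:Z - k%:Z = 0%N%:Z - d.+1%:Z by lia.
have := Gr (k%:Z - d.+1%:Z); rewrite (big_nat_recr k) //=.
have -> : k%:Z - d.+1%:Z - k%:Z = 0%N%:Z - d.+1%:Z by lia.
have -> : \sum_(1 <= i < k) F (k%:Z - d.+1%:Z - i%:Z)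
        = \sum_(1 <= i < k) G (k%:Z - d.+1%:Z - i%:Z).
  apply: eq_big_nat => i /andP[i1 ik].
  by have -> : k%:Z - d.+1%:Z - i%:Z = (k - i).-1%:Z - d%:Z by lia.
have -> : k%:Z - d.+1%:Z = k.-1%:Z - d%:Z by lia.
by rewrite IH => -> /addrI.
Qed.

End Existence.

(* Main.v *)
Require Import Defs.
From mathcomp Require Import all_boot all_order all_algebra.
From mathcomp Require Import zify ring.
From mathcomp Require Import reals complex.

Set Implicit Arguments.
Unset Strict Implicit.
Unset Printing Implicit Defensive.

Import Order.TTheory GRing.Theory Num.Theory.
Local Open Scope ring_scope.

(** The power [x ^ n] of a root [x] of the k-bonacci polynomial, [n] being any
    integer, is an integral combination of [1, x, ..., x ^ (k - 1)], and the
    coefficients do not depend on the root: they are partial sums of the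
    recurrence, the last one being [F n] and the one before it
    [F (n + 1) - F n] ([kbonacci_root_expz]).  Hence the matrix of the powers
    [0, 1, ..., k - 3, m, n] is the Vandermonde matrix times an integer matrix
    that differs from the identity in its last two columns only, and the
    determinant of the latter is its lower right 2 x 2 minor
    [(F (m + 1) - F m) * F n - (F (n + 1) - F n) * F m].

    It remains to divide by the Vandermonde determinant, which needs the roots
    to be distinct ([kbonacci_roots_inj]).  A double root [a] would also be a
    double root of [('X - 1) * kbonacci_poly C k = 'X^(k.+1) - 2 'X^k + 1]; the
    derivative forces [a = 2 k / (k + 1)], and then the value forces
    [2 (2 k)^k = (k + 1)^(k + 1)], which is impossible modulo [k]. *)

(** Coefficient of [x ^ j] in the reduction of [x ^ n] modulo the k-bonacci
    polynomial. *)
Definition expz_coef (F : int -> int) (n : int) (j : nat) : int :=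
  \sum_(1 <= s < j.+2) F (n - s%:Z).

Lemma expz_coefS F n j :
  expz_coef F (n + 1) j.+1 = F n + expz_coef F n j.
Proof.
rewrite /expz_coef big_ltn // addrK; congr (_ + _).
by rewrite big_add1 /=; apply: eq_bigr => s _; congr F; lia.
Qed.

Lemma expz_coefS0 F n : expz_coef F (n + 1) 0 = F n.
Proof. by rewrite /expz_coef big_nat1 addrK. Qed.

Section Coefficients.
Variables (k : nat) (F : int -> int).
Hypothesis hF : is_kbonacci k F.

Lemma expz_coef_last n : (0 < k)%N -> expz_coef F n k.-1 = F n.
Proof. by case: hF => _ _ Fr k0; rewrite /expz_coef [RHS]Fr prednK. Qed.

(** Shifting [n] to [n + 1] turns the coefficient [k - 2] into the coefficient
    [k - 1], up to adding [F n]. *)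
Lemma expz_coef_penult n : (1 < k)%N ->
  expz_coef F n k.-2 = F (n + 1) - F n.
Proof.
move=> k1; rewrite -(expz_coef_last (n + 1)); last exact: ltnW.
have -> : k.-1 = k.-2.+1 by lia.
by rewrite expz_coefS addrC addKr.
Qed.

End Coefficients.

Section Roots.
Variables (C : numFieldType) (k : nat).

Lemma kbonacci_rootE (x : C) :
  root (kbonacci_poly C k) x = (x ^+ k == \sum_(i < k) x ^+ i).
Proof.
rewrite rootE /kbonacci_poly !hornerE horner_sum subr_eq0.
by congr (_ == _); apply: eq_bigr => i _; rewrite hornerXn.
Qed.

Lemma kbonacci_root_neq0 (x : C) :
  (0 < k)%N -> root (kbonacci_poly C k) x -> x != 0.
Proof.
rewrite kbonacci_rootE; case: k => // p _ /eqP xE; apply/eqP => x0.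
move: xE; rewrite x0 expr0n /= big_ord_recl expr0 big1 => [|i _].
  by move/eqP; rewrite addr0 eq_sym oner_eq0.
by rewrite expr0n.
Qed.

(** Multiplying the combination on the right by [x] and reducing [x ^ k] shifts
    [n] by one, because [expz_coef F (n + 1) j.+1 = F n + expz_coef F n j].  So
    the right side is a geometric progression in [n] of ratio [x], and at
    [n = k - 1] it is [x ^ (k - 1)]. *)
Lemma kbonacci_root_expz (F : int -> int) (x : C) (n : int) : (0 < k)%N ->
  is_kbonacci k F -> root (kbonacci_poly C k) x ->
  x ^ n = \sum_(j < k) (expz_coef F n j)%:~R * x ^+ j.
Proof.
move=> k0 hF rx; have x0 := kbonacci_root_neq0 k0 rx.
pose D z : C := \sum_(j < k) (expz_coef F z j)%:~R * x ^+ j.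
have DS z : D (z + 1) = D z * x.
  have kE : k = k.-1.+1 by rewrite prednK.
  have xk : x ^+ k = \sum_(j < k) x ^+ j by apply/eqP; rewrite -kbonacci_rootE.
  have lst := expz_coef_last hF z k0.
  rewrite /D; move: xk lst; rewrite kE /= => xk lst.
  rewrite [in RHS]big_ord_recr /= lst mulrDl -mulrA -exprSr xk.
  rewrite !big_ord_recl /= expz_coefS0 expr0 mulr1 mulrDr mulr1.
  rewrite addrCA; congr (_ + _); rewrite mulr_sumr mulr_suml -big_split /=.
  apply: eq_bigr => i _.
  by rewrite /bump /= add1n expz_coefS rmorphD /= exprSr; ring.
have Dk : D (k.-1)%:Z = x ^ (k.-1)%:Z.
  have [F0 F1 _] := hF; rewrite /D.
  have kE : k = k.-1.+1 by rewrite prednK.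
  rewrite -(big_mkord xpredT (fun j => (expz_coef F k.-1%:Z j)%:~R * x ^+ j)).
  rewrite [in X in \sum_(0 <= _ < X) _]kE big_nat_recr //=.
  rewrite (expz_coef_last hF) // F1 mul1r big_nat big1 ?add0r // => j /andP[_ jk].
  rewrite /expz_coef big_nat big1 ?mul0r // => s /andP[s1 sj].
  have -> : (k.-1)%:Z - s%:Z = (k.-1 - s)%N by lia.
  by apply: F0; lia.
have Dd (d : int) : D ((k.-1)%:Z + d) = x ^ ((k.-1)%:Z + d).
  elim/int_ind: d => [|d IH|d IH]; first by rewrite addr0.
    have -> : (k.-1)%:Z + d.+1%:Z = (k.-1)%:Z + d%:Z + 1 by lia.
    by rewrite DS IH [RHS]expfzDr // expr1z.
  apply: (mulIf x0); rewrite -DS -[X in _ * X](expr1z x) -expfzDr //.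
  have -> : (k.-1)%:Z + - d.+1%:Z + 1 = (k.-1)%:Z - d%:Z by lia.
  exact: IH.
by have := Dd (n - (k.-1)%:Z); rewrite addrC subrK.
Qed.

Lemma kbonacci_polyM :
  ('X - 1) * kbonacci_poly C k = 'X^(k.+1) - 'X^k *+ 2 + 1.
Proof.
by rewrite /kbonacci_poly mulrBr -subrX1 mulrBl mul1r -exprS; ring.
Qed.

(** Modulo [k] this would read [0 = 1]. *)
Lemma double_root_obstruction : (1 < k)%N -> ((2 * k) ^ k * 2 != k.+1 ^ k.+1)%N.
Proof.
move=> k1; apply/eqP => e.
have: (k %| k.+1 ^ k.+1)%N.
  by rewrite -e dvdn_mulr // dvdn_exp ?dvdn_mull // ltnW.
have cop : coprime k (k.+1 ^ k.+1) by rewrite coprimeXr // coprimenS.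
by move/(conj (dvdnn k))/andP; rewrite -dvdn_gcd (eqP cop) dvdn1 => /eqP; lia.
Qed.

Lemma kbonacci_no_double_root (a : C) (r : {poly C}) :
  (1 < k)%N -> kbonacci_poly C k != ('X - a%:P) * (('X - a%:P) * r).
Proof.
move=> k1; apply/eqP => pE; have k0 := ltnW k1.
have ra : root (kbonacci_poly C k) a.
  by rewrite pE rootM root_XsubC eqxx.
have a0 := kbonacci_root_neq0 k0 ra.
have val : a ^+ k.+1 - a ^+ k *+ 2 + 1 = 0.
  have := congr1 (horner^~ a) kbonacci_polyM; rewrite /= hornerM (rootP ra).
  by rewrite mulr0 !hornerE => <-.
have der : a *+ k.+1 = (k%:R : C) *+ 2.
  have := congr1 (fun p => p^`().[a]) kbonacci_polyM.
  rewrite pE !derivE /= !hornerE /= !hornerMn !hornerXn.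
  rewrite subrr !(mul0r, mulr0, addr0, add0r).
  move=> /esym/eqP; rewrite subr_eq0 -{1}(prednK k0) exprSr => /eqP e.
  apply: (mulfI (expf_neq0 k.-1 a0)).
  by rewrite mulrnAr e mulr2n mulrDr !mulr_natr.
(* The value at [a] says that [a^k * (2 - a) = 1]; multiplied by [(k+1)^(k+1)],
   it becomes integral once [(k+1) * a = 2k] is substituted. *)
have := double_root_obstruction k1; apply/negP/negPn.
rewrite -(eqr_nat C) !(natrM, natrX).
have -> : (2%:R * k%:R : C) = k.+1%:R * a.
  by rewrite [LHS]mulr_natl -der mulr_natl.
rewrite exprMn exprSr -mulrA; apply/eqP; congr (_ * _).
have -> : (2%:R : C) = k.+1%:R * (2%:R - a).
  by rewrite mulrBr [_ * a]mulr_natl der -addn1 natrD; ring.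
rewrite mulrCA -[RHS]mulr1; congr (_ * _).
apply/eqP; rewrite -subr_eq0 -oppr_eq0 -val exprSr; apply/eqP; ring.
Qed.

Variable phi : 'I_k -> C.
Hypothesis hphi : kbonacci_roots phi.

Lemma kbonacci_roots_root i : root (kbonacci_poly C k) (phi i).
Proof. by rewrite hphi (bigD1 i) //= rootM root_XsubC eqxx. Qed.

Lemma kbonacci_roots_inj : (1 < k)%N -> injective phi.
Proof.
move=> k1 i j eij; apply/eqP/negPn/negP => nij.
move: hphi; rewrite /kbonacci_roots (bigD1 i) //= (bigD1 j) 1?eq_sym //= -eij => /eqP.
by apply/negP/kbonacci_no_double_root.
Qed.

Lemma gvdet_vandermonde_neq0 : (1 < k)%N ->
  gvdet phi (fun j => (j : nat)%:Z) != 0.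
Proof.
move=> k1; pose a : 'rV_k := \row_j phi j.
have -> : gvdet phi (fun j => (j : nat)%:Z) = \det (Vandermonde k a).
  rewrite /gvdet -det_tr; congr (\det _).
  by apply/matrixP => i j; rewrite !mxE.
rewrite det_Vandermonde; apply/prodf_neq0 => i _; apply/prodf_neq0 => j ij.
rewrite !mxE subr_eq0; apply/eqP => /(kbonacci_roots_inj k1) e.
by rewrite e ltnn in ij.
Qed.

End Roots.

Lemma det_mx22 (A : comNzRingType) (M : 'M[A]_2) :
  \det M = M 0 0 * M 1 1 - M 0 1 * M 1 0.
Proof.
rewrite (expand_det_row _ 0) !big_ord_recl big_ord0 /cofactor !det_mx11 !mxE /=.
rewrite addr0 expr0 mul1r expr1 mulN1r mulrN.
by congr (M _ _ * M _ _ - M _ _ * M _ _); apply/val_inj.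
Qed.

Section Determinant.
Variables (C : fieldType) (p : nat) (phi : 'I_(p + 2) -> C).

(** When [x ^ m] and [x ^ n] are the same combinations of lower powers at
    every node, the matrix of powers is the Vandermonde matrix times a block
    triangular one, whose upper left block is the identity. *)
Lemma gvdet_exponents2 (m n : int) (c d : nat -> C) :
  (forall i, phi i ^ m = \sum_(j < p + 2) c j * phi i ^+ j) ->
  (forall i, phi i ^ n = \sum_(j < p + 2) d j * phi i ^+ j) ->
  gvdet phi (exponents2 m n) =
  gvdet phi (fun j => (j : nat)%:Z) * (c p * d p.+1 - d p * c p.+1).
Proof.
move=> hm hn.
pose cd (i : nat) (j : 'I_2) := if j == 0 then c i else d i.
pose B : 'M[C]_(p + 2) := block_mx 1%:M (\matrix_(i, j) cd i j)
                           0 (\matrix_(i, j) cd (p + i)%N j).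
have detB : \det B = c p * d p.+1 - d p * c p.+1.
  by rewrite det_ublock det1 mul1r det_mx22 !mxE /cd /= addn0 addn1.
rewrite /gvdet -detB -det_mulmx; congr (\det _).
apply/matrixP => i j; rewrite mxE [RHS]mxE.
under eq_bigr => l _ do rewrite mxE.
case: (split_ordP j) => j' ->.
  have BE (l : 'I_(p + 2)) : B l (lshift 2 j') = (l == lshift 2 j')%:R.
    case: (split_ordP l) => l' ->; rewrite ?block_mxEul ?block_mxEdl mxE.
      by rewrite (inj_eq (@lshift_inj _ _)).
    by rewrite eq_rlshift.
  rewrite /exponents2 /= addnK ltn_ord (bigD1 (lshift 2 j')) //= big1.
    by rewrite addr0 BE eqxx mulr1.
  by move=> l /negPf nl; rewrite BE nl mulr0.
have BE (l : 'I_(p + 2)) (q : 'I_2) : B l (rshift p q) = cd l q.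
  by case: (split_ordP l) => l' ->; rewrite ?block_mxEur ?block_mxEdr mxE.
under eq_bigr => l _ do rewrite BE.
rewrite /exponents2 /= addnK ltnNge leq_addr /= /cd.
case: j' => -[|[|//]] ? /=; rewrite ?addn0 ?addn1 ?eqxx.
  by rewrite hm; apply: eq_bigr => l _; rewrite mulrC.
rewrite (gtn_eqF (ltnSn p)) hn; apply: eq_bigr => l _; exact: mulrC.
Qed.

End Determinant.

Theorem theorem7p1 (R : realType) (k : nat) (hk : (2 <= k)%N)
    (F : int -> int) (hF : is_kbonacci k F)
    (phi : 'I_k -> complex R) (hphi : kbonacci_roots phi) (m n : int) :
  kbonacci2 phi m n = (F n * F (m + 1) - F (n + 1) * F m)%:~R.
Proof.
have kE : k = (k.-2 + 2)%N by lia.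
move: (k.-2) kE => p kE; subst k.
have V0 := gvdet_vandermonde_neq0 hphi hk.
have k0 := ltnW hk.
have pw t i := kbonacci_root_expz t k0 hF (kbonacci_roots_root hphi i).
have cl t : expz_coef F t p.+1 = F t.
  by rewrite -[RHS](expz_coef_last hF t k0) addn2.
have cp t : expz_coef F t p = F (t + 1) - F t.
  by rewrite -(expz_coef_penult hF t hk) addn2.
rewrite /kbonacci2.
rewrite (@gvdet_exponents2 _ _ _ m n (fun j => (expz_coef F m j)%:~R)
  (fun j => (expz_coef F n j)%:~R) (pw m) (pw n)).
rewrite mulrC mulKf // !cl !cp -!rmorphM -rmorphB /=; congr (_%:~R); ring.
Qed.
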